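(* Let $p$ be a prime, $q=p^\lambda$ with $\lambda\ge1$, and let $F$ be a field with $\mathbb F_q\subseteq F$. Let $W=\{w_t(x)\}_{t=0}^\infty$ and $V=\{v_t(x)\}_{t=0}^\infty$ be two sequences of $\mathbb F_q$-linear polynomials in $F[x]$, with termwise sum $W+V=\{w_t(x)+v_t(x)\}_{t=0}^\infty$. Then in $F[x]\{\{\mathfrak D\}\}$ one has $$f_{P_W}(x)\cdot f_{P_V}(x)=f_{P_{(W+V)}}(x).$$
   Context: A polynomial in $F[x]$ is $\mathbb F_q$-linear if it is a finite $F$-linear combination of monomials $x^{q^n}$, $n\ge0$. For a sequence $E=\{e_t(x)\}_{t=0}^\infty$ of $\mathbb F_q$-linear polynomials and an integer $i\ge0$ with $q$-adic expansion $i=\sum_t i_tq^t$ ($0\le i_t<q$), put $p_{E,i}(x):=\prod_t e_t(x)^{i_t}$ (with $e^0=1$), $P_E:=\{p_{E,i}(x)\}_{i=0}^\infty$, and $f_{P_E}(x):=\sum_{i\ge0}p_{E,i}(x)\mathfrak D_i\in F[x]\{\{\mathfrak D\}\}$. $F[x]\{\{\mathfrak D\}\}$ is the commutative ring of formal series $\sum_{i\ge0}a_i\mathfrak D_i$ ($a_i\in F[x]$) with coefficientwise addition and multiplication $(\sum_i a_i\mathfrak D_i)(\sum_j b_j\mathfrak D_j)=\sum_n\big(\sum_{i=0}^n\binom ni a_ib_{n-i}\big)\mathfrak D_n$. *)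

(* Defs.v *)
From HB Require Import structures.
From mathcomp Require Import all_boot all_order all_algebra.
From mathcomp Require Import boolp ring.

Set Implicit Arguments.
Unset Strict Implicit.
Unset Printing Implicit Defensive.

Import GRing.Theory.
Local Open Scope ring_scope.

(* R{{D}}: [DPSeries a] is the formal series sum_i a_i D_i. *)
Record dpseries (R : Type) := DPSeries { dpcoef : nat -> R }.

HB.instance Definition _ (R : Type) := gen_eqMixin (dpseries R).
HB.instance Definition _ (R : Type) := gen_choiceMixin (dpseries R).

Lemma dpseriesP (R : Type) (a b : dpseries R) :
  (forall n, dpcoef a n = dpcoef b n) -> a = b.
Proof. by case: a b => [a] [b] h; congr DPSeries; apply/funext. Qed.

Section Ring.
Variable R : comNzRingType.
Implicit Types a b c : dpseries R.

Definition dp_zero : dpseries R := DPSeries (fun=> 0).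
Definition dp_one : dpseries R := DPSeries (fun n => (n == 0)%:R).
Definition dp_opp a : dpseries R := DPSeries (fun n => - dpcoef a n).
Definition dp_add a b : dpseries R :=
  DPSeries (fun n => dpcoef a n + dpcoef b n).
Definition dp_mul a b : dpseries R :=
  DPSeries (fun n =>
    \sum_(i < n.+1) (dpcoef a i * dpcoef b (n - i)) *+ 'C(n, i)).

Lemma dp_addA : associative dp_add.
Proof. by move=> a b c; apply: dpseriesP => n /=; rewrite addrA. Qed.

Lemma dp_addC : commutative dp_add.
Proof. by move=> a b; apply: dpseriesP => n /=; rewrite addrC. Qed.

Lemma dp_add0 : left_id dp_zero dp_add.
Proof. by move=> a; apply: dpseriesP => n /=; rewrite add0r. Qed.

Lemma dp_addN : left_inverse dp_zero dp_opp dp_add.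
Proof. by move=> a; apply: dpseriesP => n /=; rewrite addNr. Qed.

HB.instance Definition _ :=
  GRing.isZmodule.Build (dpseries R) dp_addA dp_addC dp_add0 dp_addN.

Lemma dp_mulC : commutative dp_mul.
Proof.
move=> a b; apply: dpseriesP => n /=.
rewrite (reindex_inj rev_ord_inj) /=; apply: eq_bigr => i _.
have le_in : (i <= n)%N by rewrite -ltnS.
by rewrite subSS subKn // bin_sub // mulrC.
Qed.

Lemma dp_mul1 : left_id dp_one dp_mul.
Proof.
move=> a; apply: dpseriesP => n /=.
rewrite big_ord_recl /= mul1r subn0 bin0 big1 ?addr0 // => i _.
by rewrite mul0r mul0rn.
Qed.

Lemma dp_mulDl : left_distributive dp_mul dp_add.
Proof.
move=> a b c; apply: dpseriesP => n /=.
by rewrite -big_split; apply: eq_bigr => i _; rewrite mulrDl mulrnDl.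
Qed.

Lemma bin_mul_bin n i j : (i + j <= n)%N ->
  ('C(n, i + j) * 'C(i + j, i) = 'C(n, i) * 'C(n - i, j))%N.
Proof.
move=> h; have hi : (i <= n)%N by apply: leq_trans h; rewrite leq_addr.
have hj : (j <= n - i)%N by rewrite leq_subRL.
have := bin_fact h; have := bin_fact (leq_addr j i).
have := bin_fact hi; have := bin_fact hj; rewrite addKn subnDA.
move=> e1 e2 e3 e4; apply/eqP.
have pos : (0 < i`! * (j`! * (n - i - j)`!))%N by rewrite !muln_gt0 !fact_gt0.
rewrite -(eqn_pmul2r pos); apply/eqP; transitivity n`!.
  by rewrite -e4 -e3; ring.
by rewrite -e2 -e1; ring.
Qed.

Lemma dp_mulA : associative dp_mul.
Proof.
move=> a b c; apply: dpseriesP => n /=.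
pose F i l := dpcoef a i * dpcoef b (l - i)%N * dpcoef c (n - l)%N.
transitivity (\sum_(i < n.+1) \sum_(l < n.+1 | (i <= l)%N)
    F i l *+ ('C(n, l) * 'C(l, i))).
  apply: eq_bigr => i _; have le_in : (i <= n)%N by rewrite -ltnS.
  rewrite mulr_sumr -sumrMnl.
  rewrite -(big_geq_mkord _ _ xpredT (fun l => F i l *+ ('C(n, l) * 'C(l, i)))).
  have -> : index_iota i n.+1 = index_iota (0 + i) n.+1 by [].
  rewrite big_addn subSn // big_mkord.
  apply: eq_bigr => j _; have le_j : (j <= n - i)%N by rewrite -ltnS.
  have le_ij : (i + j <= n)%N by rewrite -leq_subRL.
  rewrite addnC bin_mul_bin // /F addKn subnDA.
  by rewrite mulrnAr mulrA -mulrnA mulnC.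
rewrite (exchange_big_dep xpredT) //=; apply: eq_bigr => l _.
rewrite mulr_suml -sumrMnl.
rewrite (big_ord_widen n.+1 (fun i => ((dpcoef a i * dpcoef b (l - i)) *+ 'C(l, i)
  * dpcoef c (n - l)) *+ 'C(n, l))) //.
apply: eq_big => [i|i _]; first by rewrite ltnS.
by rewrite mulrnAl -mulrnA mulnC.
Qed.

Lemma dp_one_neq0 : dp_one != 0.
Proof.
apply/eqP => /(congr1 (fun a => dpcoef a 0)) /eqP.
by rewrite /= oner_eq0.
Qed.

HB.instance Definition _ := GRing.Zmodule_isComNzRing.Build (dpseries R)
  dp_mulA dp_mulC dp_mul1 dp_mulDl dp_one_neq0.

End Ring.

Definition Fq_linear (F : fieldType) (q : nat) (e : {poly F}) : Prop :=
  exists (m : nat) (c : nat -> F), e = \sum_(n < m) c n *: 'X^(q ^ n).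

Definition qdigit (q i t : nat) : nat := ((i %/ q ^ t) %% q)%N.

(* The product over t is cut at t <= i: for q >= 2 the digits i_t with t > i
   vanish (see [qdigit_gt]), and [qdigit_sum] is the expansion itself. *)
Definition pE (F : fieldType) (q : nat) (E : nat -> {poly F}) (i : nat) :
    {poly F} :=
  \prod_(t < i.+1) E t ^+ qdigit q i t.

Lemma qdigit_gt q i t : (1 < q)%N -> (i < t)%N -> qdigit q i t = 0%N.
Proof.
move=> q1 it; rewrite /qdigit divn_small ?mod0n //.
exact: ltn_trans it (ltn_expl t q1).
Qed.

Lemma qdigit_sum q i : (1 < q)%N ->
  (i = \sum_(t < i.+1) qdigit q i t * q ^ t)%N.
Proof.
move=> q1; have q0 : (0 < q)%N by apply: ltnW.
have H m : (i = \sum_(t < m) qdigit q i t * q ^ t + i %/ q ^ m * q ^ m)%N.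
  elim: m => [|m IH]; first by rewrite big_ord0 expn0 divn1 muln1.
  rewrite big_ord_recr /= -addnA {1}IH; congr (_ + _)%N.
  rewrite {1}(divn_eq (i %/ q ^ m) q) mulnDl addnC; congr (_ + _)%N.
  by rewrite -divnMA -expnSr expnS mulnA.
rewrite {1}(H i.+1) divn_small ?mul0n ?addn0 //.
exact: ltn_trans (ltnSn i) (ltn_expl i.+1 q1).
Qed.

Definition fPE (F : fieldType) (q : nat) (E : nat -> {poly F}) :
    dpseries {poly F} :=
  DPSeries (pE q E).

(* Main.v *)
(* Write n = s + m q and i = r + j q with r, s < q. By Lucas' theorem, in
   characteristic p, binom(n, i) = binom(s, r) binom(m, j), and p_E splits off
   the factor e_0^r, leaving the polynomial of index j of the shifted sequence.
   Hence the n-th coefficient of the product factors as the binomial expansion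
   of (w_0 + v_0)^s times the m-th coefficient for the shifted sequences, and
   one concludes by induction on n. *)
Require Import Defs.
From HB Require Import structures.
From mathcomp Require Import all_boot all_order all_algebra.
From mathcomp Require Import finfield.
Import GRing.Theory.
Local Open Scope ring_scope.

Section LucasPower.
Variables (R : comNzRingType) (q : nat).
Hypothesis q_pnat : [pchar R].-nat q.

Lemma coef_XD1n n i : (('X + 1) ^+ n : {poly R})`_i = 'C(n, i)%:R.
Proof.
have -> : ('X + 1) ^+ n = \poly_(j < n.+1) 'C(n, j)%:R :> {poly R}.
  by rewrite exprD1n poly_def; apply: eq_bigr => j _; rewrite scaler_nat.
by rewrite coef_poly ltnS; case: leqP => // /bin_small ->.
Qed.

(** Compares coefficients in [('X + 1) ^+ (n + q) = ('X + 1) ^+ n * ('X^q + 1)], where the last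
    factor is the Frobenius identity for a power [q] of the characteristic. *)
Lemma natr_bin_addq n i :
  'C(n + q, i)%:R = 'C(n, i)%:R + (if (i < q)%N then 0 else 'C(n, i - q)%:R)
  :> R.
Proof.
rewrite -!coef_XD1n exprD.
have -> : ('X + 1) ^+ q = 'X^q + 1 :> {poly R}.
  by rewrite exprDn_pchar ?expr1n // (eq_pnat _ (@pchar_poly R)).
by rewrite mulrDr mulr1 addrC coefD coefMXn.
Qed.

(** Induction on [m]: raising the upper index by [q] acts on ['C(m, j)] as Pascal's rule, while
    ['C(s, r)] stays a common factor. *)
Lemma natr_bin_lucas s m r j : (s < q)%N -> (r < q)%N ->
  'C(s + m * q, r + j * q)%:R = 'C(s, r)%:R * 'C(m, j)%:R :> R.
Proof.
move=> s_lt r_lt; elim: m j => [|m IHm] [|j].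
- by rewrite !addn0 mulr1.
- rewrite mulr0 bin_small // addn0 (leq_trans s_lt) // mulSn addnCA.
  exact: leq_addr.
- by rewrite mulSn addnCA addnC natr_bin_addq IHm !addn0 r_lt addr0 !bin0.
- rewrite mulSn addnCA addnC natr_bin_addq IHm.
  have -> : (r + j.+1 * q = r + j * q + q)%N by rewrite mulSn addnCA addnC.
  by rewrite ltnNge leq_addl /= addnK IHm binS natrD mulrDr.
Qed.

End LucasPower.

Section Digits.
Variables (F : fieldType) (q : nat).
Hypothesis q_gt1 : (1 < q)%N.

Lemma pE_widen (E : nat -> {poly F}) i m : (i < m)%N ->
  pE q E i = \prod_(t < m) E t ^+ qdigit q i t.
Proof.
move=> lt_im; rewrite /pE (big_ord_widen m (fun t => E t ^+ qdigit q i t)) //.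
rewrite big_mkcond; apply: eq_bigr => t _; case: ltnP => // lt_it.
by rewrite qdigit_gt.
Qed.

(** The base-[q] digits of [r + m * q] are [r] followed by those of [m]. *)
Lemma pE_addmul (E : nat -> {poly F}) r m : (r < q)%N ->
  pE q E (r + m * q) = E 0%N ^+ r * pE q (fun t => E t.+1) m.
Proof.
move=> r_lt; have q_gt0 : (0 < q)%N by apply: ltnW.
(* One extra factor, of exponent zero, so that more than [m] factors remain once [t = 0] is split
   off. *)
rewrite (@pE_widen _ _ (r + m * q).+2) // big_ord_recl.
congr (_ ^+ _ * _).
  by rewrite /qdigit expn0 divn1 addnC modnMDl modn_small.
rewrite (@pE_widen _ _ (r + m * q).+1); last first.
  by rewrite ltnS (leq_trans _ (leq_addl _ _)) // leq_pmulr.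
have div_q : ((r + m * q) %/ q = m)%N.
  by rewrite addnC divnMDl // (divn_small r_lt) addn0.
by apply: eq_bigr => t _; rewrite /qdigit lift0 expnS divnMA div_q.
Qed.

End Digits.

Lemma sum_ord_digits (R : nmodType) (q m : nat) (f : nat -> R) :
  \sum_(i < m * q) f i = \sum_(j < m) \sum_(r < q) f (r + j * q)%N.
Proof.
rewrite -(big_mkord xpredT f) big_nat_mul big_mkord; apply: eq_bigr => j _.
by rewrite -{1}[(j * q)%N]add0n big_addn mulSn addnK big_mkord.
Qed.

Lemma pE_add (F : fieldType) (q : nat) (W V : nat -> {poly F}) n :
  (1 < q)%N -> [pchar F].-nat q ->
  \sum_(i < n.+1) (pE q W i * pE q V (n - i)) *+ 'C(n, i) =
    pE q (fun t => W t + V t) n.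
Proof.
move=> q_gt1 q_pnat; have q_gt0 : (0 < q)%N by apply: ltnW.
have q_pnatP : [pchar {poly F}].-nat q by rewrite (eq_pnat _ (@pchar_poly F)).
elim/ltn_ind: n W V => n IHn W V.
have [->|n_gt0] := posnP n.
  rewrite big_ord1 /pE !big_ord1 /qdigit !div0n !mod0n !expr0 mulr1.
  by rewrite bin0.
have s_lt : (n %% q < q)%N by rewrite ltn_mod.
have m_lt : (n %/ q < n)%N by rewrite ltn_Pdiv.
have {IHn} IHm := IHn _ m_lt; clear n_gt0 m_lt.
rewrite (divn_eq n q) addnC; set s := (n %% q)%N in s_lt *.
set m := (n %/ q)%N in IHm *; move: s m => s m in s_lt IHm *.
(* The swap by [addrC] makes [exprDn] give [W 0] the exponent [r], the low digit of [i]. *)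
rewrite (pE_addmul _ _ q_gt1) // -IHm addrC exprDn mulr_sumr.
(* The sum is extended to full blocks of length [q]; the binomials of the new terms vanish. *)
have le_n : ((s + m * q).+1 <= m.+1 * q)%N by rewrite mulSn -addSn leq_add2r.
pose f i := (pE q W i * pE q V (s + m * q - i)) *+ 'C(s + m * q, i).
rewrite (big_ord_widen _ f le_n) big_mkcond /=.
transitivity (\sum_(i < m.+1 * q) f i).
  apply: eq_bigr => i _; rewrite ltnS /f.
  by case: leqP => // /bin_small ->.
rewrite sum_ord_digits {}/f.
apply: eq_bigr => j _; rewrite mulr_suml.
rewrite (big_ord_widen q (fun r => V 0%N ^+ (s - r) * W 0%N ^+ r *+ 'C(s, r) *
  (pE q (fun t => W t.+1) j * pE q (fun t => V t.+1) (m - j) *+ 'C(m, j)))) //.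
rewrite [RHS]big_mkcond; apply: eq_bigr => r _.
rewrite -[LHS]mulr_natr (natr_bin_lucas _ _ q_pnatP) // ltnS.
(* For [r > s] both sides vanish with ['C(s, r)]. For [r <= s] the subtraction [n - i] needs no
   borrow, so it acts separately on low digit and quotient. *)
case: leqP => [le_rs|/bin_small ->]; last by rewrite mul0r mulr0.
have le_jm : (j <= m)%N by rewrite -ltnS.
have -> : (s + m * q - (r + j * q) = (s - r) + (m - j) * q)%N.
  by rewrite mulnBl addnBA ?leq_mul2r ?le_jm ?orbT // subnDA addnBAC.
rewrite !(pE_addmul _ _ q_gt1) //; last by rewrite (leq_ltn_trans (leq_subr _ _)).
rewrite -natrM mulr_natr mulnC mulrnA mulrnAl mulrnAr mulrACA.
by rewrite [W 0%N ^+ r * _]mulrC.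
Qed.

Theorem theorem3 (p lambda : nat) (Fq : finFieldType) (F : fieldType)
    (iota : {rmorphism Fq -> F}) (W V : nat -> {poly F}) :
  prime p ->
  (1 <= lambda)%N ->
  #|Fq| = (p ^ lambda)%N ->
  (forall t, Fq_linear (p ^ lambda) (W t)) ->
  (forall t, Fq_linear (p ^ lambda) (V t)) ->
  fPE (p ^ lambda) W * fPE (p ^ lambda) V =
    fPE (p ^ lambda) (fun t => W t + V t).
Proof.
move=> p_pr lambda_gt0 card_Fq _ _; apply: dpseriesP => n; apply: pE_add.
  by rewrite -[1%N](expn0 p) ltn_exp2l ?prime_gt1.
(* [Fq] has characteristic [p] by its cardinality, and [iota] carries this to [F]. *)
have pcharF := rmorph_pchar iota (card_finPcharP card_Fq p_pr).
by rewrite pnatX (eq_pnat _ (pcharf_eq pcharF)) pnat_id.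
Qed.
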